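(* Let $(L,\cdot,[\;,\;])$ be a transposed Poisson algebra. Suppose that $D$ is a derivation of both $(L,\cdot)$ and $(L,[\;,\;])$. Then for the 3-Lie algebra $(L,[\;,\;,\;])$ defined by $$[x,y,z]:=D(x)\cdot[y,z]+D(y)\cdot[z,x]+D(z)\cdot[x,y],\quad\forall x,y,z\in L,$$ the triple $(L,\cdot,[\;,\;,\;])$ is a transposed Poisson 3-Lie algebra, in the sense that the following additional equation holds: $$3u\cdot[x,y,z]=[x\cdot u,y,z]+[x,y\cdot u,z]+[x,y,z\cdot u],\quad\forall x,y,z,u\in L.$$
   Context: All vector spaces are over a field $K$ of characteristic zero. Commutative associative algebras are not assumed unital. Derivations are $K$-linear. A transposed Poisson algebra is a triple $(L,\cdot,[\;,\;])$ where $(L,\cdot)$ is a commutative associative algebra, $(L,[\;,\;])$ is a Lie algebra, and $2z\cdot[x,y]=[z\cdot x,y]+[x,z\cdot y]$ for all $x,y,z\in L$. A 3-Lie algebra is a vector space $A$ with a skew-symmetric trilinear map $[\;,\;,\;]:\otimes^3A\to A$ such that, for all $x,y,z,u,v\in A$, $[[x,y,z],u,v]=[[x,u,v],y,z]+[[y,u,v],z,x]+[[z,u,v],x,y]$. (It is a result of the paper that the ternary operation in the claim makes $L$ a 3-Lie algebra.) A transposed Poisson 3-Lie algebra is a triple $(L,\cdot,[\;,\;,\;])$ where $(L,\cdot)$ is a commutative associative algebra, $(L,[\;,\;,\;])$ is a 3-Lie algebra, and $3u\cdot[x,y,z]=[x\cdot u,y,z]+[x,y\cdot u,z]+[x,y,z\cdot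 u]$ for all $x,y,z,u\in L$. *)

(* Defs.v *)
From HB Require Import structures.
From mathcomp Require Import all_boot all_order all_algebra.

Set Implicit Arguments.
Unset Strict Implicit.
Unset Printing Implicit Defensive.

Import GRing.Theory.

Local Open Scope ring_scope.

(* MathComp's algebra structures are unital, so products and brackets are
   operations on an [lmodType] together with predicates. *)

Definition bilinear_op (K : fieldType) (L : lmodType K) (m : L -> L -> L) :
    Prop :=
  (forall x : L, linear (m x)) /\ (forall y : L, linear (fun x : L => m x y)).

Definition trilinear_op (K : fieldType) (L : lmodType K)
    (t : L -> L -> L -> L) : Prop :=
  [/\ forall y z : L, linear (fun x : L => t x y z),
      forall x z : L, linear (fun y : L => t x y z)
    & forall x y : L, linear (fun z : L => t x y z)].

Definition comm_assoc_algebra (K : fieldType) (L : lmodType K)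
    (m : L -> L -> L) : Prop :=
  [/\ bilinear_op m, commutative m & associative m].

Definition lie_algebra (K : fieldType) (L : lmodType K)
    (b : L -> L -> L) : Prop :=
  [/\ bilinear_op b,
      forall x : L, b x x = 0
    & forall x y z : L, b x (b y z) + b y (b z x) + b z (b x y) = 0].

Definition transposed_poisson_algebra (K : fieldType) (L : lmodType K)
    (m b : L -> L -> L) : Prop :=
  [/\ comm_assoc_algebra m,
      lie_algebra b
    & forall x y z : L, m z (b x y) *+ 2 = b (m z x) y + b x (m z y)].

(* Transpositions of adjacent arguments generate the symmetric group on the
   three arguments. *)
Definition skew_symmetric3 (K : fieldType) (L : lmodType K)
    (t : L -> L -> L -> L) : Prop :=
  (forall x y z : L, t y x z = - t x y z) /\
  (forall x y z : L, t x z y = - t x y z).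

Definition lie3_algebra (K : fieldType) (L : lmodType K)
    (t : L -> L -> L -> L) : Prop :=
  [/\ trilinear_op t,
      skew_symmetric3 t
    & forall x y z u v : L,
        t (t x y z) u v =
        t (t x u v) y z + t (t y u v) z x + t (t z u v) x y].

Definition transposed_poisson_lie3_algebra (K : fieldType) (L : lmodType K)
    (m : L -> L -> L) (t : L -> L -> L -> L) : Prop :=
  [/\ comm_assoc_algebra m,
      lie3_algebra t
    & forall x y z u : L,
        m u (t x y z) *+ 3 =
        t (m x u) y z + t x (m y u) z + t x y (m z u)].

Definition derivation (K : fieldType) (L : lmodType K) (m : L -> L -> L)
    (D : {linear L -> L}) : Prop :=
  forall x y : L, D (m x y) = m (D x) y + m x (D y).

Definition derived_bracket3 (K : fieldType) (L : lmodType K)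
    (m b : L -> L -> L) (D : {linear L -> L}) (x y z : L) : L :=
  m (D x) (b y z) + m (D y) (b z x) + m (D z) (b x y).

(* Main.v *)
Require Import Defs.
From HB Require Import structures.
From mathcomp Require Import all_boot all_order all_algebra.
From mathcomp Require Import ring.

Set Implicit Arguments.
Unset Strict Implicit.
Unset Printing Implicit Defensive.

Import GRing.Theory.

Local Open Scope ring_scope.

(** Write [xy] for [mul x y], [[x, y]] for [br x y] and [t] for the ternary
    bracket. Everything rests on four identities of a transposed Poisson
    algebra, in which sums run over the cyclic permutations of [x, y, z]:
    - [mul_br_cyclic]: the sum of [x[y, z]] vanishes, as its double expands
      into brackets that cancel in pairs;
    - [br_mul_br_cyclic]: the sum of [[x, h[y, z]]] vanishes, by the Jacobi
      identities for [(hx, y, z)], [(x, hy, z)], [(x, y, hz)] and [h] times the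
      one for [(x, y, z)];
    - [mul_br_br_cyclic]: the sum of [[h, x][y, z]] vanishes, its double being
      reduced by the first identity to the second one;
    - [mul_br_exchange]: [b[z, aw] + a[bw, z] = - wz[a, b]], by the first
      identity for [(aw, b, z)] and [(a, bw, z)], [w] times the one for
      [(a, b, z)], and the compatibility of [w] with [[a, b]].

    The compatibility of [t] with the product is the sum of the binary
    compatibilities multiplied by [Dx], [Dy], [Dz], minus [Du] times
    [mul_br_cyclic].

    For the fundamental identity, [mul_br_cyclic] first simplifies [D (t x y z)]
    to the cyclic sum of [DDx[y, z] - x[Dy, Dz]]. The terms are then sorted
    according to the variables to which [D] is applied, and each group
    vanishes separately:
    - the terms in [DDx], [DDy], [DDz] agree on both sides;
    - those in [DDu] or [DDv] cancel by [mul_br_br_cyclic];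
    - those in [Du] and [Dv] by [mul_br_cyclic];
    - those in [Dx] and [Dy], and cyclically, by [mul_br_exchange];
    - those in [Dx] and [Du], and similarly, by [mul_br_nested], which combines
      [mul_br_exchange] and [br_mul_br_cyclic].

    The underlying algebra need not have a unit and its product is only a function; to
    compare sums of products, it is embedded in its unitization, a
    commutative ring in which [ring] decides the equalities. *)

(** * Unitization of a commutative associative algebra *)

Section Unitization.

Variables (K : fieldType) (L : lmodType K) (mul : L -> L -> L).

(** The carrier [K * L] of the unitization, in which [(a, x)] stands for
    [a 1 + x]. The axioms of [mul] are a parameter of the type, so that a
    commutative ring structure can be attached to it. *)
Definition unitization (_ : comm_assoc_algebra mul) : Type := (K * L)%type.

Hypothesis Lmul : comm_assoc_algebra mul.

Lemma alg_mulC : commutative mul. Proof. by case: Lmul. Qed.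

Lemma alg_mulA : associative mul. Proof. by case: Lmul. Qed.

Lemma alg_mulDr x y z : mul x (y + z) = mul x y + mul x z.
Proof. by case: Lmul => -[lin _] _ _; rewrite -[y]scale1r lin !scale1r. Qed.

Lemma alg_mulDl x y z : mul (x + y) z = mul x z + mul y z.
Proof. by rewrite !(alg_mulC _ z) alg_mulDr. Qed.

Lemma alg_mul0r x : mul x 0 = 0.
Proof. by apply: (addrI (mul x 0)); rewrite -alg_mulDr !addr0. Qed.

Lemma alg_mulNr x y : mul x (- y) = - mul x y.
Proof.
by apply: (addrI (mul x y)); rewrite -alg_mulDr !subrr alg_mul0r.
Qed.

Lemma alg_mulZr a x y : mul x (a *: y) = a *: mul x y.
Proof.
by case: Lmul => -[lin _] _ _; rewrite -[a *: y]addr0 lin alg_mul0r addr0.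
Qed.

Lemma alg_mulZl a x y : mul (a *: x) y = a *: mul x y.
Proof. by rewrite !(alg_mulC _ y) alg_mulZr. Qed.

HB.instance Definition _ := GRing.Zmodule.copy (unitization Lmul) (K * L)%type.

Definition unitization_one : unitization Lmul := (1, 0).

Definition unitization_mul (p q : unitization Lmul) : unitization Lmul :=
  (p.1 * q.1, p.1 *: q.2 + q.1 *: p.2 + mul p.2 q.2).

Fact unitization_mulA : associative unitization_mul.
Proof.
move=> [a x] [b y] [c z]; congr (_, _) => /=; first exact: mulrA.
rewrite !alg_mulDr !alg_mulDl !alg_mulZr !alg_mulZl !scalerDr !scalerA alg_mulA.
rewrite [c * a]mulrC [c * b]mulrC.
by rewrite [LHS](AC (4*3) (1*(2*4*6)*(3*5*7))).
Qed.

Fact unitization_mulC : commutative unitization_mul.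
Proof.
move=> [a x] [b y]; congr (_, _) => /=; first exact: mulrC.
by rewrite alg_mulC [X in X + _]addrC.
Qed.

Fact unitization_mul1 : left_id unitization_one unitization_mul.
Proof.
move=> [a x]; congr (_, _) => /=; first exact: mul1r.
by rewrite scale1r scaler0 addr0 alg_mulC alg_mul0r addr0.
Qed.

Fact unitization_mulDl : left_distributive unitization_mul +%R.
Proof.
move=> [a x] [b y] [c z]; congr (_, _) => /=; first exact: mulrDl.
by rewrite scalerDl scalerDr alg_mulDl [LHS](AC (2*2*2) ((1*3*5)*(2*4*6))).
Qed.

Fact unitization_one_neq0 : unitization_one != 0.
Proof. by apply/eqP => -[] /eqP; rewrite oner_eq0. Qed.

HB.instance Definition _ := GRing.Zmodule_isComNzRing.Build (unitization Lmul)
  unitization_mulA unitization_mulC unitization_mul1 unitization_mulDl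
  unitization_one_neq0.

(** The embedding of [L] into its unitization. *)
Definition unitize (x : L) : unitization Lmul := (0, x).

Fact unitize_is_zmod_morphism : zmod_morphism unitize.
Proof. by move=> x y; congr (_, _); rewrite subr0. Qed.

HB.instance Definition _ := GRing.isZmodMorphism.Build L (unitization Lmul)
  unitize unitize_is_zmod_morphism.

Lemma unitize_inj : injective unitize. Proof. by move=> x y []. Qed.

Lemma unitizeM x y : unitize (mul x y) = unitize x * unitize y.
Proof. by congr (_, _) => /=; rewrite ?mul0r // !scale0r !add0r. Qed.

Lemma unitizeD x y : unitize (x + y) = unitize x + unitize y.
Proof. exact: raddfD. Qed.

Lemma unitizeN x : unitize (- x) = - unitize x.
Proof. exact: raddfN. Qed.

Lemma unitize0 : unitize 0 = 0. Proof. exact: raddf0. Qed.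

(** Pushes the embedding through sums, opposites and products. *)
Definition unitizeE := (unitize0, unitizeD, unitizeN, unitizeM).

End Unitization.

(** * Identities in a transposed Poisson algebra *)

(** Proves [a = b] as a linear combination of known equalities: their
    combination is [c = d], and the second premise is left to [ring]. *)
Lemma eq_of_subr_eq (V : zmodType) (a b c d : V) :
  c = d -> a - b = c - d -> a = b.
Proof. by move=> -> /eqP; rewrite subrr subr_eq0 => /eqP. Qed.

Section TransposedPoisson.

Variables (K : fieldType) (L : lmodType K) (mul br : L -> L -> L).
Hypothesis charK : [pchar K] =i pred0.
Hypothesis tpL : transposed_poisson_algebra mul br.

Let Lmul : comm_assoc_algebra mul. Proof. by case: tpL. Qed.
Local Notation emb := (unitize Lmul).
Local Notation mulC := (alg_mulC Lmul).
Local Notation mulDr := (alg_mulDr Lmul).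
Local Notation mulNr := (alg_mulNr Lmul).
Local Notation unitizeE := (unitizeE Lmul).

Lemma double_eq0 (x : L) : x *+ 2 = 0 -> x = 0.
Proof.
move=> /eqP; rewrite -scaler_nat scaler_eq0 => /orP[|/eqP //].
by have := charK 2; rewrite !inE /= => ->.
Qed.

Lemma br_linearr x : linear (br x). Proof. by case: tpL => _ [[]]. Qed.

Lemma br_linearl y : linear (br^~ y). Proof. by case: tpL => _ [[]]. Qed.

Lemma brxx x : br x x = 0. Proof. by case: tpL => _ []. Qed.

Lemma jacobi x y z : br x (br y z) + br y (br z x) + br z (br x y) = 0.
Proof. by case: tpL => _ []. Qed.

Lemma transposed_leibniz z x y :
  mul z (br x y) *+ 2 = br (mul z x) y + br x (mul z y).
Proof. by case: tpL. Qed.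

Lemma brDr x y z : br x (y + z) = br x y + br x z.
Proof. by rewrite -[y]scale1r br_linearr !scale1r. Qed.

Lemma brDl x y z : br (x + y) z = br x z + br y z.
Proof. by rewrite -[x]scale1r br_linearl !scale1r. Qed.

Lemma brC x y : br x y = - br y x.
Proof.
have := brxx (x + y); rewrite brDl !brDr !brxx add0r addr0 => /eqP.
by rewrite addr_eq0 => /eqP.
Qed.

Lemma br0r x : br x 0 = 0.
Proof. by apply: (addrI (br x 0)); rewrite -brDr !addr0. Qed.

Lemma brNr x y : br x (- y) = - br x y.
Proof. by apply: (addrI (br x y)); rewrite -brDr !subrr br0r. Qed.

Lemma brNl x y : br (- x) y = - br x y.
Proof. by rewrite brC brNr -brC. Qed.

Lemma mul_br_cyclic x y z :
  mul x (br y z) + mul y (br z x) + mul z (br x y) = 0.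
Proof.
apply: double_eq0; rewrite !mulrnDl !transposed_leibniz.
rewrite (mulC y x) (mulC z x) (mulC z y).
rewrite (brC (mul x y) z) (brC (mul y z) x) (brC (mul x z) y).
by apply: (@unitize_inj _ _ _ Lmul); ring.
Qed.

Lemma br_mul_br_cyclic h x y z :
  br x (mul h (br y z)) + br y (mul h (br z x)) + br z (mul h (br x y)) = 0.
Proof.
(* [mul h (br v w)] doubled, inside the bracket with [u] *)
have double u v w : br u (br (mul h v) w) + br u (br v (mul h w))
    = br u (mul h (br v w)) *+ 2.
  by rewrite -brDr -transposed_leibniz !mulr2n brDr.
have hJ : mul h (br x (br y z) + br y (br z x) + br z (br x y)) *+ 2 = 0.
  by rewrite jacobi (alg_mul0r Lmul) mul0rn.
rewrite !mulDr !mulrnDl !transposed_leibniz in hJ.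
(* With [S] the sum to cancel and [T] the cyclic sum of the terms
   [br (mul h x) (br y z)], [J] and [double] give [S *+ 2 + T = 0], while [hJ]
   gives [S + T = 0]. *)
have J := f_equal2 +%R (jacobi (mul h x) y z)
  (f_equal2 +%R (jacobi x (mul h y) z) (jacobi x y (mul h z))).
have D := f_equal2 +%R (double x y z)
  (f_equal2 +%R (double y z x) (double z x y)).
apply: (@unitize_inj _ _ _ Lmul).
apply: (eq_of_subr_eq (f_equal emb
  (f_equal2 +%R J (f_equal2 +%R (esym hJ) (esym D))))).
ring.
Qed.

Lemma mul_br_br_cyclic h x y z :
  mul (br h x) (br y z) + mul (br h y) (br z x) + mul (br h z) (br x y) = 0.
Proof.
have cyc u v : mul v (br h u) - mul u (br h v) = - mul h (br u v).
  apply: (@unitize_inj _ _ _ Lmul).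
  apply: (eq_of_subr_eq (f_equal emb (mul_br_cyclic h u v))).
  rewrite (brC v h) !mulNr; ring.
apply: double_eq0; rewrite !mulrnDl !transposed_leibniz.
(* The six terms of the doubled sum pair up into three differences of this
   form. *)
have E u v w : br (mul (br h u) v) w - br (mul (br h v) u) w
    = br w (mul h (br u v)).
  by rewrite -brNl -brDl !(mulC (br h _)) cyc brNl -brC.
rewrite (brC y) (brC z) (brC x); apply: (@unitize_inj _ _ _ Lmul).
rewrite -(br_mul_br_cyclic h x y z) -!E; ring.
Qed.

Lemma mul_br_exchange w a b z :
  mul b (br z (mul a w)) + mul a (br (mul b w) z)
  = - mul w (mul z (br a b)).
Proof.
have T := f_equal (mul z) (transposed_leibniz w a b).
have W := f_equal (mul w) (mul_br_cyclic a b z).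
have A := f_equal2 +%R (mul_br_cyclic (mul w a) b z)
  (mul_br_cyclic a (mul w b) z).
apply: (@unitize_inj _ _ _ Lmul); rewrite !(mulC _ w).
apply: (eq_of_subr_eq (f_equal emb
  (f_equal2 +%R A (f_equal2 +%R T (f_equal -%R W))))).
rewrite (alg_mul0r Lmul) mulr2n !unitizeE; ring.
Qed.

(** Moves the outer factor [d] of a nested product under the inner bracket, as
    is needed for the terms of the fundamental identity in which [D] is applied
    to one of [x, y, z] and to one of [u, v]. *)
Lemma mul_br_nested d a v y z :
  mul d (br v (mul a (br y z)))
  = mul a (br (mul d (br v y)) z) + mul a (br y (mul d (br v z)))
    - mul v (mul (br a d) (br y z)).
Proof.
have E := mul_br_exchange (br y z) a d v.
have B := f_equal (mul a) (br_mul_br_cyclic d v y z).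
apply: (@unitize_inj _ _ _ Lmul).
apply: (eq_of_subr_eq (f_equal emb (f_equal2 +%R E B))).
rewrite (alg_mul0r Lmul) (brC z v) !(brC (mul _ _)) !unitizeE.
rewrite !(mulNr, brNr) !unitizeE; ring.
Qed.

(** * The ternary bracket defined by a derivation *)

Variable D : {linear L -> L}.
Hypotheses (Dmul : derivation mul D) (Dbr : derivation br D).

Local Notation t := (derived_bracket3 mul br D).

(** The six terms in which [D] hits both a factor and an argument of the bracket
    regroup, by [mul_br_cyclic], into three. *)
Lemma derived_bracket3_derivation x y z :
  D (t x y z)
  = mul (D (D x)) (br y z) + mul (D (D y)) (br z x) + mul (D (D z)) (br x y)
    - (mul x (br (D y) (D z)) + mul y (br (D z) (D x))
       + mul z (br (D x) (D y))).
Proof.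
have A := f_equal2 +%R (mul_br_cyclic (D x) (D y) z)
  (f_equal2 +%R (mul_br_cyclic (D y) (D z) x) (mul_br_cyclic (D z) (D x) y)).
apply: (@unitize_inj _ _ _ Lmul).
apply: (eq_of_subr_eq (f_equal emb A)).
rewrite /derived_bracket3 !linearD /= !Dmul !Dbr !unitizeE; ring.
Qed.

Lemma derived_bracket3_trilinear : trilinear_op t.
Proof.
split=> [y z|x z|x y] c p q; rewrite /derived_bracket3 linearP;
  rewrite !(br_linearr, br_linearl) (alg_mulDl Lmul) !mulDr;
  by rewrite (alg_mulZl Lmul) !(alg_mulZr Lmul) !scalerDr
    [LHS](AC (2*2*2) ((1*3*5)*(2*4*6))).
Qed.

Lemma derived_bracket3_skew : skew_symmetric3 t.
Proof.
by split=> x y z; apply: (@unitize_inj _ _ _ Lmul);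
  rewrite /derived_bracket3 (brC z y) (brC z x) (brC y x) !mulNr; ring.
Qed.

Lemma derived_bracket3_fundamental x y z u v :
  t (t x y z) u v = t (t x u v) y z + t (t y u v) z x + t (t z u v) x y.
Proof.
have DDu := f_equal (mul (D (D u))) (mul_br_br_cyclic v x y z).
have DDv := f_equal (mul (D (D v))) (mul_br_br_cyclic u x y z).
have DuDv := f_equal (mul (br (D u) (D v))) (mul_br_cyclic x y z).
have Exy := f_equal2 +%R (mul_br_exchange (br u v) (D x) (D y) z)
  (f_equal2 +%R (mul_br_exchange (br u v) (D y) (D z) x)
     (mul_br_exchange (br u v) (D z) (D x) y)).
have Nu := f_equal2 +%R (mul_br_nested (D u) (D x) v y z)
  (f_equal2 +%R (mul_br_nested (D u) (D y) v z x)
     (mul_br_nested (D u) (D z) v x y)).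
have Nv := f_equal2 +%R (mul_br_nested (D v) (D x) u y z)
  (f_equal2 +%R (mul_br_nested (D v) (D y) u z x)
     (mul_br_nested (D v) (D z) u x y)).
have E := f_equal2 +%R (f_equal2 +%R (esym DDu) DDv)
  (f_equal2 +%R (f_equal2 +%R DuDv (esym Exy))
     (f_equal2 +%R Nu (f_equal -%R Nv))).
apply: (@unitize_inj _ _ _ Lmul); apply: (eq_of_subr_eq (f_equal emb E)).
rewrite {E Nu Nv Exy DuDv DDu DDv} !(alg_mul0r Lmul).
have tE a b c : t a b c = mul (D a) (br b c) + mul (D b) (br c a)
    + mul (D c) (br a b) by [].
rewrite ![t (t _ _ _) _ _]tE !derived_bracket3_derivation !tE !(brDl, brDr).
(* Skew-symmetry puts the arguments of each bracket in the order
   [x, y, z, u, v], with products last, so that opposite brackets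
   are no longer distinct atoms. *)
rewrite !(brC (mul _ _)) ?(brC y x) ?(brC z x) ?(brC z y).
rewrite ?(brC u x) ?(brC u y) ?(brC u z).
rewrite ?(brC v x) ?(brC v y) ?(brC v z) ?(brC v u).
rewrite ?(brC (D y) (D x)) ?(brC (D z) (D x)) ?(brC (D z) (D y)).
rewrite ?(brC (D u) (D x)) ?(brC (D u) (D y)) ?(brC (D u) (D z)).
rewrite ?(brC (D v) (D x)) ?(brC (D v) (D y)) ?(brC (D v) (D z)).
rewrite ?(brC (D v) (D u)) !(mulNr, brNr) !unitizeE.
ring.
Qed.

Lemma derived_bracket3_leibniz x y z u :
  mul u (t x y z) *+ 3 = t (mul x u) y z + t x (mul y u) z + t x y (mul z u).
Proof.
have T := f_equal2 +%R (f_equal (mul (D x)) (transposed_leibniz u y z))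
  (f_equal2 +%R (f_equal (mul (D y)) (transposed_leibniz u z x))
     (f_equal (mul (D z)) (transposed_leibniz u x y))).
have A := f_equal (mul (D u)) (mul_br_cyclic x y z).
apply: (@unitize_inj _ _ _ Lmul).
apply: (eq_of_subr_eq (f_equal emb (f_equal2 +%R T (f_equal -%R A)))).
rewrite (alg_mul0r Lmul) !mulr2n /derived_bracket3 !(mulC _ u) !Dmul.
rewrite !unitizeE; ring.
Qed.

End TransposedPoisson.

Theorem proposition4p7 (K : fieldType) (hK : [pchar K] =i pred0)
    (L : lmodType K) (mul br : L -> L -> L)
    (hL : transposed_poisson_algebra mul br)
    (D : {linear L -> L})
    (hDmul : derivation mul D) (hDbr : derivation br D) :
  transposed_poisson_lie3_algebra mul (derived_bracket3 mul br D).
Proof.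
split; first by case: hL.
  split.
  - exact: derived_bracket3_trilinear hL D.
  - exact: derived_bracket3_skew hL D.
  - exact: derived_bracket3_fundamental hK hL D hDmul hDbr.
exact: derived_bracket3_leibniz hK hL D hDmul.
Qed.
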